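(* Let $n,m,k$ be positive integers with $k\notin\{n,m\}$. Then the equation $x^n+y^m=z^k$ is not partition regular on $\mathbb{N}$, except for the constant solution $x=y=z=2$ of equations $x^n+y^n=z^{n+1}$. That is: there exists a finite coloring of $\mathbb{N}$ for which the equation $x^n+y^m=z^k$ has no monochromatic solution other than, in the case $n=m$ and $k=n+1$, the constant solution $x=y=z=2$.
   Context: $\mathbb{N}$ denotes the set of positive integers. An equation $f(x_1,\ldots,x_n)=0$ is partition regular on $\mathbb{N}$ if for every finite coloring (partition) $\mathbb{N}=C_1\cup\ldots\cup C_r$ there exist an index $i$ and elements $a_1,\ldots,a_n\in C_i$ (not necessarily distinct) with $f(a_1,\ldots,a_n)=0$; such a solution is called monochromatic. A solution is constant if all unknowns take the same value. *)

(* Defs.v *)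
From mathcomp Require Import all_boot.

Set Implicit Arguments.
Unset Strict Implicit.
Unset Printing Implicit Defensive.

(* The positive integers are the n : nat with 0 < n. A finite coloring is a map
   c : nat -> 'I_r, whose value at 0 is irrelevant: class number i is
   {n > 0 | c n = i}. *)
Definition monochromatic_solution (r : nat) (c : nat -> 'I_r)
    (E : nat -> nat -> nat -> Prop) (x y z : nat) : Prop :=
  [/\ [/\ 0 < x, 0 < y & 0 < z],
      exists i : 'I_r, [/\ c x = i, c y = i & c z = i]
    & E x y z].

(* Main.v *)
Require Import Defs.
From mathcomp Require Import all_boot.
From mathcomp Require Import zify.

(** In a solution of x ^ n + y ^ m = z ^ k the larger of the two summands is
    within a factor 2 of z ^ k, so z ^ k is comparable to x ^ n or to y ^ m.
    Take x ^ n.  After one logarithm, log z and log x are in ratio about n / k,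
    which is not 1; after a second one, log log z and log log x differ by about
    the non-zero constant log (n / k).  That difference being bounded,
    colouring a number by its rounded double logarithm modulo a large integer
    separates x from z ([loglog_mod_neq]), provided that both are large and that
    the double logarithm is scaled up enough, before rounding, to see the
    constant.

    Giving every small number a colour of its own leaves only the constant
    solutions t ^ n + t ^ m = t ^ k, which force t = 2, n = m and k = n + 1
    ([constant_solution]). *)

Lemma leq_mul_trunc_log {u v a b} : 0 < u -> 0 < v -> 0 < b ->
  u ^ a <= 2 * v ^ b -> a * trunc_log 2 u <= b * (trunc_log 2 v).+1.
Proof.
move=> u_gt0 v_gt0 b_gt0 le_uv.
rewrite -ltnS -(ltn_exp2l (m := 2)) // expnS mulnC (mulnC b) !expnM.
have lb : (2 ^ trunc_log 2 u) ^ a <= u ^ a.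
  by case: a {le_uv} => // a; rewrite leq_exp2r // trunc_logP.
apply: leq_ltn_trans (leq_trans lb le_uv) _.
by rewrite ltn_pmul2l // ltn_exp2r // trunc_log_ltn.
Qed.

(** Bernoulli's inequality (1 + 1 / d) ^ d >= 2, cleared of denominators. *)
Lemma double_expn_leq d : 0 < d -> 2 * d ^ d <= d.+1 ^ d.
Proof.
move=> d_gt0.
have bernoulli j : d ^ j * (d + j) <= d * d.+1 ^ j.
  elim: j => [|j IHj]; first by rewrite !expn0; lia.
  rewrite !expnS; move: (d ^ j) (d.+1 ^ j) IHj => p q; nia.
by rewrite -(leq_pmul2l d_gt0); have := bernoulli d; lia.
Qed.

(** The double logarithm in base 2, scaled by d and rounded down. *)
Definition loglog d x := trunc_log 2 (trunc_log 2 x ^ d).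

(** If u ^ a and v ^ b agree up to a factor 2, then log u / log v is about
    b / a >= 1 + 1 / s.  For large u and v the ratio of the integer logarithms
    still lies between 1 + 1 / (2 s) and 2 ^ s, so the ratio of their 2 s-th
    powers lies between 2 and 2 ^ (s * 2 s). *)
Lemma loglog_gap {s u v a b} :
    0 < a -> a < b -> b <= s -> 2 ^ (2 * s) <= u -> 2 ^ (2 * s) <= v ->
    u ^ a <= 2 * v ^ b -> v ^ b <= 2 * u ^ a ->
  loglog (2 * s) v < loglog (2 * s) u <= loglog (2 * s) v + s * (2 * s).
Proof.
move=> a_gt0 lt_ab le_bs u_big v_big le_uv le_vu.
have pow_gt0 : 0 < 2 ^ (2 * s) by rewrite expn_gt0.
have u_gt0 : 0 < u by exact: leq_trans u_big.
have v_gt0 : 0 < v by exact: leq_trans v_big.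
have b_gt0 : 0 < b by exact: ltn_trans lt_ab.
have := leq_mul_trunc_log u_gt0 v_gt0 b_gt0 le_uv.
have := leq_mul_trunc_log v_gt0 u_gt0 a_gt0 le_vu.
have : 2 * s <= trunc_log 2 v by exact: trunc_log_max.
rewrite /loglog; set h := trunc_log 2 u; set g := trunc_log 2 v.
move=> g_big le_gh le_hg; set d := 2 * s in g_big *.
have d_gt0 : 0 < d by lia.
have g_gt0 : 0 < g by lia.
apply/andP; split.
  have ratio : g * d.+1 <= h * d.
    (* b >= a + 1 gives h + 1 >= g + g / a, and g >= 2 s absorbs the rounding. *)
    have : a.+1 * g <= b * g by rewrite leq_mul2r lt_ab orbT.
    have : s * d <= s * g by rewrite leq_mul2l g_big orbT.
    have : a * g <= s * g by nia.
    rewrite -(leq_pmul2l a_gt0) /d; nia.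
  rewrite -trunc_logMp ?expn_gt0 ?g_gt0 //; apply: leq_trunc_log.
  rewrite -(leq_pmul2r (m := d ^ d)) ?expn_gt0 ?d_gt0 // -expnMn.
  apply: leq_trans (_ : (g * d.+1) ^ d <= _); last by rewrite leq_exp2r.
  by rewrite expnMn -mulnA mulnCA leq_mul2l double_expn_leq ?orbT.
have trunc_logMpow j p : 0 < p ->
    trunc_log 2 (2 ^ j * p) = trunc_log 2 p + j.
  move=> p_gt0; elim: j => [|j IHj]; first by rewrite mul1n addn0.
  by rewrite expnS -mulnA trunc_logMp ?IHj ?addnS // muln_gt0 expn_gt0.
rewrite -trunc_logMpow ?expn_gt0 ?g_gt0 //; apply: leq_trunc_log.
rewrite expnM -expnMn leq_exp2r //.
have le_h : h <= 2 * b * g by nia.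
have le_pow : 2 * b <= 2 ^ s.
  apply: leq_trans (_ : 2 ^ b <= _); last by rewrite leq_exp2l.
  by case: b b_gt0 {lt_ab le_bs le_uv le_vu le_gh le_hg le_h} => // b _;
     rewrite expnS leq_mul2l ltn_expl.
by rewrite (leq_trans le_h) // leq_mul2r le_pow orbT.
Qed.

Lemma loglog_mod_neq {s u v a b} :
    0 < a -> 0 < b -> a <> b -> a <= s -> b <= s ->
    2 ^ (2 * s) <= u -> 2 ^ (2 * s) <= v ->
    u ^ a <= 2 * v ^ b -> v ^ b <= 2 * u ^ a ->
  loglog (2 * s) u <> loglog (2 * s) v %[mod (s * (2 * s)).+1].
Proof.
have mod_neq i j w : i < j <= i + w -> j <> i %[mod w.+1].
  move=> /andP[lt_ij le_j] /eqP; rewrite eqn_mod_dvd ?(ltnW lt_ij) //.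
  by move=> /dvdn_leq; lia.
move=> a_gt0 b_gt0 ab_neq le_as le_bs u_big v_big le_uv le_vu.
have [lt_ab|lt_ba|//] := ltngtP a b.
  by apply: mod_neq; apply: loglog_gap lt_ab _ _ _ _ _.
by apply/nesym/mod_neq; apply: loglog_gap lt_ba _ _ _ _ _.
Qed.

(** Dividing by the smaller power of t on the left shows that n = m, since
    t divides t ^ (k - n) but is prime to 1 + t ^ j for j > 0; what is left is
    2 = t ^ (k - n). *)
Lemma constant_solution {n m k t} : 0 < t -> t ^ n + t ^ m = t ^ k ->
  [/\ n = m, k = n.+1 & t = 2].
Proof.
move=> t_gt0.
wlog le_nm : n m / n <= m => [Hwlog|].
  have [/Hwlog//|/ltnW/Hwlog H] := leqP n m.
  by rewrite addnC => /H[-> -> ->].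
move=> eq_t.
have t_gt1 : 1 < t.
  by case: t t_gt0 eq_t => [|[|t]] // _; rewrite !exp1n.
have lt_nk : n < k.
  by rewrite -(ltn_exp2l (m := t)) // -eq_t -addn1 leq_add2l expn_gt0 t_gt0.
have eq_div : 1 + t ^ (m - n) = t ^ (k - n).
  apply/eqP; rewrite -(eqn_pmul2l (m := t ^ n)) ?expn_gt0 ?t_gt0 //.
  by rewrite mulnDr muln1 -!expnD !subnKC ?(ltnW lt_nk) ?eq_t.
have t_dvd : t %| t ^ (k - n) by rewrite dvdn_exp ?subn_gt0.
have eq_nm : n = m.
  apply/eqP; rewrite eqn_leq le_nm leqNgt; apply/negP => lt_nm.
  move: t_dvd; rewrite -eq_div dvdn_addl ?dvdn_exp ?subn_gt0 // dvdn1.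
  by move: t_gt1 => /[swap] /eqP->.
move: t_dvd eq_div; rewrite -eq_nm subnn => t_dvd eq_div.
have t2 : t = 2.
  by move: t_dvd; rewrite -eq_div => /dvdn_leq; lia.
split=> //; move: eq_div; rewrite t2 => /(@expnI 2 isT 1); lia.
Qed.

Theorem corollary2p12 (n m k : nat) (n_gt0 : 0 < n) (m_gt0 : 0 < m)
    (k_gt0 : 0 < k) (k_neq_n : k <> n) (k_neq_m : k <> m) :
  exists (r : nat) (c : nat -> 'I_r),
    forall x y z : nat,
      monochromatic_solution c (fun x y z => x ^ n + y ^ m = z ^ k) x y z ->
      [/\ n = m, k = n.+1 & [/\ x = 2, y = 2 & z = 2]].
Proof.
pose s := n + m + k; pose N := 2 ^ (2 * s); pose w := s * (2 * s).
pose col x : 'I_N.+1 * 'I_w.+1 :=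
  (inord (minn x N), inord (loglog (2 * s) x %% w.+1)).
have colP x y : col x = col y ->
    minn x N = minn y N /\ loglog (2 * s) x = loglog (2 * s) y %[mod w.+1].
  case=> /(congr1 val) /= eq_min /(congr1 val) /= eq_mod; move: eq_min eq_mod.
  by rewrite !inordK ?ltn_pmod // ltnS geq_minr.
exists #|{: 'I_N.+1 * 'I_w.+1}|, (fun x => enum_rank (col x)).
move=> x y z [[x_gt0 y_gt0 z_gt0] [i [cx cy cz]] eq_xyz].
have /colP[min_xz mod_xz] : col x = col z by apply: enum_rank_inj; rewrite cx.
have /colP[min_yz mod_yz] : col y = col z by apply: enum_rank_inj; rewrite cy.
have [lt_zN|z_big] := ltnP z N.
  have [xz yz] : x = z /\ y = z by lia.
  move: eq_xyz; rewrite xz yz => /(constant_solution z_gt0)[-> -> ->].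
  by split.
have [x_big y_big] : N <= x /\ N <= y by lia.
exfalso; have [le_yx|/ltnW le_xy] := leqP (y ^ m) (x ^ n).
  by apply: (@loglog_mod_neq s x z n k) mod_xz => //; lia.
by apply: (@loglog_mod_neq s y z m k) mod_yz => //; lia.
Qed.
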